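(* Let $p\equiv 1\pmod 4$ be a prime. Let $\mathcal{R}_p$ be the set of $3\times 3$ grids over $\mathbb{F}_p$ that arise as the entrywise reduction modulo $p$ of some primitive magic square of squares whose central entry is divisible by $p$. Then $$|\mathcal{R}_p|\le (p-1)\left(|C_p| + \begin{cases}4 & p\equiv 1\pmod 8,\\ 2 & p\equiv 5\pmod 8\end{cases}\right),$$ where $C_p=\{n\in S_p : n+1\in S_p \text{ and } n+2\in S_p\}$ and $S_p=\{x^2 : x\in\mathbb{F}_p,\ x\neq 0\}$.
   Context: $\mathbb{F}_p$ is the field of residues modulo $p$. A primitive magic square of squares is a $3\times 3$ grid of nine distinct integer squares $a^2,b^2,c^2$ (top row), $d^2,e^2,f^2$ (middle row), $g^2,h^2,i^2$ (bottom row) such that all rows, columns and both main diagonals have the same sum and the greatest common divisor of the nine entries is $1$; its central entry is $e^2$. *)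

(* Defs.v *)
From mathcomp Require Import all_boot all_order all_algebra.
From mathcomp Require Import boolp.

Set Implicit Arguments.
Unset Strict Implicit.
Unset Printing Implicit Defensive.

Import GRing.Theory.
Local Open Scope ring_scope.

Definition is_magic (R : nmodType) (M : 'M[R]_3) : Prop :=
  exists s : R,
    [/\ forall i, \sum_j M i j = s,
        forall j, \sum_i M i j = s,
        \sum_i M i i = s
      & \sum_i M i (rev_ord i) = s].

(* The entries of M are the squares themselves, not their roots. *)
Definition primitive_magic_square_of_squares (M : 'M[int]_3) : Prop :=
  [/\ forall i j, exists a : int, M i j = a ^+ 2,
      injective (fun ij : 'I_3 * 'I_3 => M ij.1 ij.2),
      is_magic M
    & \big[gcdn/0%N]_(i < 3) \big[gcdn/0%N]_(j < 3) `|M i j|%N = 1%N].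

Definition reduce_grid (p : nat) (M : 'M[int]_3) : 'M['F_p]_3 :=
  map_mx (fun z : int => z%:~R) M.

(* Indices run over 0, 1, 2, so M 1 1 is the central entry; being a reduction of
   some integer grid is not decidable a priori, hence the classical `[< >]. *)
Definition R_ (p : nat) : {set 'M['F_p]_3} :=
  [set N | `[< exists M : 'M[int]_3,
      [/\ primitive_magic_square_of_squares M,
          (p%:Z %| M 1%R 1%R)%Z
        & N = reduce_grid p M] >]].

Definition S_ (p : nat) : {set 'F_p} := [set x ^+ 2 | x : 'F_p & x != 0].

Definition C_ (p : nat) : {set 'F_p} :=
  [set n in S_ p | (n + 1 \in S_ p) && (n + 2 \in S_ p)].

(* Main.v *)
(** Modulo [p] the centre of the grid vanishes, hence so does the magic sum, and
    the grid is determined by its top corners [a] and [c]: the other entries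
    are, up to sign, [a], [c], [a + c] and [a - c]. Since the gcd is [1], [a]
    and [c] are not both zero. So [(a, c)] is a nonzero square times a vector
    that is [(1, 0)], [(0, 1)], [(1, 1)], [(-1, 1)], or [(n + 1, 1)] with [n] in [C_ p].
    As there are at most [(p - 1) / 2] nonzero squares, this gives the bound
    [(p - 1) / 2 * (#|C_ p| + 4)], which is stronger than the one claimed in
    both residue classes. *)

Require Import Defs.
From mathcomp Require Import all_boot all_order all_algebra.
From mathcomp Require Import finfield boolp ring zify.

Set Implicit Arguments.
Unset Strict Implicit.
Unset Printing Implicit Defensive.

Import GRing.Theory.
Local Open Scope ring_scope.

Lemma forall_ord3 (P : 'I_3 -> Prop) : P 0 -> P 1 -> P 2%:R -> forall i, P i.
Proof.
move=> P0 P1 P2 [[|[|[|//]]] lti].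
- by rewrite (_ : Ordinal lti = 0) //; apply: val_inj.
- by rewrite (_ : Ordinal lti = 1) //; apply: val_inj.
- by rewrite (_ : Ordinal lti = 2%:R) //; apply: val_inj.
Qed.

Lemma sum_ord3 (V : nmodType) (F : 'I_3 -> V) :
  \sum_i F i = F 0 + F 1 + F 2%:R.
Proof.
rewrite !big_ord_recl big_ord0 addr0 addrA.
by congr (F _ + F _ + F _); apply: val_inj.
Qed.

Lemma magic_center0 (R : comNzRingType) (M : 'M[R]_3) (a := M 0 0)
    (c := M 0 2%:R) :
  is_magic M -> M 1 1 = 0 ->
  [/\ M 0 1 = - (a + c), M 1 0 = c - a & M 1 2%:R = a - c] /\
  [/\ M 2%:R 0 = - c, M 2%:R 1 = a + c & M 2%:R 2%:R = - a].
Proof.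
rewrite {}/a {}/c => -[s [rowM colM]].
rewrite !sum_ord3.
have -> : rev_ord (0 : 'I_3) = 2%:R by apply: val_inj.
have -> : rev_ord (1 : 'I_3) = 1 by apply: val_inj.
have -> : rev_ord (2%:R : 'I_3) = 0 by apply: val_inj.
have := (rowM 0, rowM 1, rowM 2%:R, (colM 0, colM 1, colM 2%:R)).
rewrite !sum_ord3 => -[[[r0 r1] r2] [[c0 c1] c2]] d1 d2 e0.
rewrite e0 !addr0 in r1 c1 d1 d2.
(* As the centre is zero, the middle row, the middle column and the two diagonals together contain
   each outer entry once, just as the three rows do. Hence [4s - 3s = 0], with no division, so any
   characteristic is allowed. *)
have s0 : s = 0.
  have: (M 1 0 + M 1 2%:R) + (M 0 1 + M 2%:R 1) + (M 0 0 + M 2%:R 2%:R)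
    + (M 0 2%:R + M 2%:R 0) - (M 0 0 + M 0 1 + M 0 2%:R)
    - (M 1 0 + M 1 2%:R) - (M 2%:R 0 + M 2%:R 1 + M 2%:R 2%:R) = 0 by ring.
  rewrite r0 r1 r2 c1 d1 d2 => <-; ring.
rewrite {}s0 in r0 r1 r2 c0 c1 c2 d1 d2.
have b_eq : M 0 1 = - (M 0 0 + M 0 2%:R).
  by apply/eqP; rewrite -addr_eq0 -r0; apply/eqP; ring.
have g_eq : M 2%:R 0 = - M 0 2%:R by apply/eqP; rewrite -addr_eq0 addrC d2.
have i_eq : M 2%:R 2%:R = - M 0 0 by apply/eqP; rewrite -addr_eq0 addrC d1.
have d_eq : M 1 0 = M 0 2%:R - M 0 0.
  by rewrite g_eq in c0; apply/eqP; rewrite -subr_eq0 -c0; apply/eqP; ring.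
split; split=> //.
- by apply/eqP; rewrite -subr_eq0 -r1 d_eq; apply/eqP; ring.
- by apply/eqP; rewrite -subr_eq0 -c1 b_eq; apply/eqP; ring.
Qed.

Lemma magic_center0_inj (R : comNzRingType) (M N : 'M[R]_3) :
  is_magic M -> M 1 1 = 0 -> is_magic N -> N 1 1 = 0 ->
  M 0 0 = N 0 0 -> M 0 2%:R = N 0 2%:R -> M = N.
Proof.
move=> magM M0 magN N0 eqa eqc; apply/matrixP.
have [[? ? ?] [? ? ?]] := magic_center0 magM M0.
have [[? ? ?] [? ? ?]] := magic_center0 magN N0.
by apply: forall_ord3; apply: forall_ord3; congruence.
Qed.

Lemma map_magic (R S : pzRingType) (f : {rmorphism R -> S}) (M : 'M[R]_3) :
  is_magic M -> is_magic (map_mx f M).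
Proof.
move=> [s [rowM colM d1 d2]]; exists (f s); split=> [i|j||].
- by rewrite -(rowM i) rmorph_sum; apply: eq_bigr => j _; rewrite mxE.
- by rewrite -(colM j) rmorph_sum; apply: eq_bigr => i _; rewrite mxE.
- by rewrite -d1 rmorph_sum; apply: eq_bigr => i _; rewrite mxE.
- by rewrite -d2 rmorph_sum; apply: eq_bigr => i _; rewrite mxE.
Qed.

Lemma intrFp_eq0 (p : nat) (z : int) :
  prime p -> ((z%:~R : 'F_p) == 0) = (p%:Z %| z)%Z.
Proof.
move=> p_prime; rewrite dvdzE /=.
have natF n : ((n%:R : 'F_p) == 0) = (p %| n)%N.
  by rewrite (dvdn_pcharf (pchar_Fp p_prime)).
by case: z => n; rewrite ?NegzE ?rmorphN ?oppr_eq0 ?abszN; exact: natF.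
Qed.

Lemma S_P (p : nat) (x : 'F_p) :
  reflect (exists2 u, u != 0 & x = u ^+ 2) (x \in S_ p).
Proof.
by apply: (iffP imsetP) => -[u u0 ->]; exists u => //; move: u0; rewrite inE.
Qed.

Lemma S_div (p : nat) (x y : 'F_p) : x \in S_ p -> y \in S_ p -> x / y \in S_ p.
Proof.
move=> /S_P[u u0 ->] /S_P[v v0 ->]; apply/S_P; exists (u / v).
  by rewrite mulf_neq0 ?invr_eq0.
by rewrite expr_div_n.
Qed.

(** By Fermat, every nonzero square is a root of [X^n - 1] with [n = (p - 1) / 2], and this
    polynomial has at most [n] roots. *)
Lemma card_S (p : nat) : prime p -> odd p -> (#|S_ p| * 2 <= p - 1)%N.
Proof.
move=> p_prime p_odd; have p_gt1 := prime_gt1 p_prime.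
have [n p_eq n_gt0] : exists2 n, p = (n * 2).+1 & (0 < n)%N.
  by exists p./2; lia.
suff: (#|S_ p| <= n)%N by lia.
rewrite cardE; apply: max_unity_roots (enum_uniq _) => //.
apply/allP => x; rewrite mem_enum => /S_P[u u0 ->]; apply/unity_rootP.
rewrite -exprM mulnC; apply: (mulfI u0).
by rewrite mulr1 -exprS -p_eq; have := expf_card u; rewrite card_Fp.
Qed.

Lemma R_P (p : nat) (N : 'M['F_p]_3) : prime p -> N \in R_ p ->
  [/\ is_magic N, N 1 1 = 0, N != 0 & forall i j, N i j != 0 -> N i j \in S_ p].
Proof.
move=> p_prime; rewrite inE => /asboolP[M [[sqM _ magM gcdM] pM ->]].
split.
- exact: (map_magic intr).
- by apply/eqP; rewrite mxE intrFp_eq0.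
(* This is where primitivity enters: if every entry vanished mod [p], then [p] would divide their
   gcd. *)
- apply/eqP => /matrixP M0; have: (p %| 1)%N.
    rewrite -gcdM; apply/dvdn_biggcdP => i _; apply/dvdn_biggcdP => j _.
    by have /eqP := M0 i j; rewrite !mxE intrFp_eq0 // dvdzE.
  by rewrite dvdn1 => /eqP p1; rewrite p1 in p_prime.
- move=> i j; rewrite mxE; have [a ->] := sqM i j; rewrite rmorphXn /= => a0.
  apply/S_P; exists (a%:~R) => //.
  by apply: contraNneq a0 => ->; rewrite expr0n.
Qed.

(** Representatives of the possible ratios of the corners [a] and [c]. The four listed vectors are
    the cases where [c], [a], [a - c] or [a + c] vanishes. *)
Definition corner_directions (p : nat) : {set 'F_p * 'F_p} :=
  [set:: [:: (1, 0); (0, 1); (1, 1); (-1, 1)]] :|: [set (n + 1, 1) | n in C_ p].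

Lemma card_corner_directions (p : nat) :
  (#|corner_directions p| <= #|C_ p| + 4)%N.
Proof.
rewrite addnC; apply: leq_trans (leq_card_setU _ _) _.
apply: leq_add (leq_imset_card _ _).
by rewrite cardsE; apply: card_size.
Qed.

Lemma corners_R (p : nat) (N : 'M['F_p]_3) : prime p -> N \in R_ p ->
  (N 0 0, N 0 2%:R) \in
  [set (s * d.1, s * d.2) | s in S_ p, d in corner_directions p].
Proof.
move=> p_prime NR; have [magN N0 Nneq0 sqN] := R_P p_prime NR.
have [[Nb Nd Nf] [Ng Nh Ni]] := magic_center0 magN N0.
have := sqN 2%:R 1; have := sqN 1 2%:R; rewrite Nf Nh.
have := sqN 0 2%:R; have := sqN 0 0.
have: (N 0 0 != 0) || (N 0 2%:R != 0).
  rewrite -negb_and; apply: contraNN Nneq0 => /andP[/eqP a0 /eqP c0].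
  (* The zero grid is magic with zero centre and zero corners, so [N] would equal it. *)
  apply/eqP/(magic_center0_inj magN N0); rewrite ?mxE //.
  by exists 0; split=> *; rewrite big1 // => *; rewrite mxE.
move: (N 0 0) (N 0 2%:R) => a c ac0 Sa Sc Sf Sh.
have [c0|cN0] := eqVneq c 0.
  rewrite {}c0 eqxx orbF in ac0 *; apply/imset2P; exists a (1, 0) => //.
  - exact: Sa.
  - by rewrite !inE eqxx.
  - by rewrite mulr1 mulr0.
(* A nonzero corner is an entry of the grid, hence a square, so [c] itself can serve as the scaling
   factor. *)
apply/imset2P; exists c (a / c, 1); rewrite ?Sc //=; last first.
  by rewrite mulr1 mulrC divfK.
have [->|aN0] := eqVneq a 0; first by rewrite mul0r !inE eqxx !orbT.
have [->|acN0] := eqVneq a c; first by rewrite divff // !inE eqxx !orbT.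
have [aNc|aNcN0] := eqVneq (a + c) 0.
  have -> : a = - c by apply/eqP; rewrite -addr_eq0 aNc.
  by rewrite mulNr divff // !inE eqxx !orbT.
rewrite inE; apply/orP; right; apply/imsetP.
(* The entries [a - c], [a], [a + c] are now nonzero squares in arithmetic progression with step
   [c]. Dividing by the square [c] gives three consecutive nonzero squares, so [n] is
   [(a - c) / c]. *)
have t_eq : (a - c) / c + 1 = a / c by field.
have t1_eq : (a - c) / c + 2%:R = (a + c) / c by field.
exists ((a - c) / c); last by rewrite t_eq.
by rewrite inE t_eq t1_eq !S_div ?Sc ?Sa ?Sf ?Sh // subr_eq0.
Qed.

Lemma card_R (p : nat) : prime p -> (#|R_ p| <= #|S_ p| * (#|C_ p| + 4))%N.
Proof.
move=> p_prime; pose corners (N : 'M['F_p]_3) := (N 0 0, N 0 2%:R).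
rewrite -(@card_in_imset _ _ corners) => [|M N MR NR [eqa eqc]]; last first.
  have [magM M0 _ _] := R_P p_prime MR; have [magN N0 _ _] := R_P p_prime NR.
  exact: magic_center0_inj eqa eqc.
have sub : corners @: R_ p \subset
    [set (s * d.1, s * d.2) | s in S_ p, d in corner_directions p].
  by apply/subsetP => _ /imsetP[N NR ->]; apply: corners_R.
apply: leq_trans (subset_leq_card sub) _.
rewrite curry_imset2X; apply: leq_trans (leq_imset_card _ _) _.
by rewrite cardsX leq_mul2l card_corner_directions orbT.
Qed.

Local Close Scope ring_scope.

Theorem theorem6p1 (p : nat) (p_prime : prime p) (p_mod4 : p = 1 %[mod 4]) :
  #|R_ p| <= (p - 1) * (#|C_ p| + (if p == 1 %[mod 8] then 4 else 2)).
Proof.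
have p_odd : odd p by lia.
have S2 := card_S p_prime p_odd.
apply: leq_trans (card_R p_prime) _.
(* Halving [p - 1] pays for the 4: [#|C_ p| + 4] is at most [2 * (#|C_ p| + 2)]. The constant 2 then
   serves both residue classes. *)
apply: (@leq_trans ((p - 1) * (#|C_ p| + 2))).
  apply: leq_trans (leq_mul S2 (leqnn _)).
  by rewrite -mulnA leq_mul2l; apply/orP; right; lia.
by rewrite leq_mul2l leq_add2l; case: ifP; rewrite orbT.
Qed.
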